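(* Let $a$ and $n$ be nonnegative integers such that $a\geq 3$. Then (a) $\displaystyle \bigl((a-1)n+1\bigr)\ \Big|\ \gcd\left(\binom{(a-1)^2n-1}{(a-1)n},\ \binom{a(a-1)n}{2(a-1)n+1}\right)$, (b) $\displaystyle \bigl((a-1)n-1\bigr)\ \Big|\ \gcd\left(\binom{(a-1)^2n-1}{(a-1)n-2},\ \binom{a(a-1)n-2}{2(a-1)n-3}\right)$.
   Context: Divisibility is in the integers. Binomial coefficients are the usual ones, $\binom{N}{M}=\frac{N!}{M!(N-M)!}$ for integers $N\geq M\geq 0$, and $\binom{N}{M}=0$ otherwise (negative arguments occur only for $n=0$ in (a), and for $n=0$ in (b)). All the expressions $(a-1)n-1$ etc. are computed in $\mathbb{Z}$. *)

(* Defs.v *)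
From mathcomp Require Import all_boot all_order all_algebra.

Set Implicit Arguments.
Unset Strict Implicit.
Unset Printing Implicit Defensive.

Local Open Scope ring_scope.

(* N! / (M! (N - M)!) when 0 <= M <= N, and 0 for all other integers N, M, in
   particular for negative arguments.  The absolute values only convert the
   (then nonnegative) arguments to nat. *)
Definition binz (N M : int) : int :=
  if (0 <= M) && (M <= N) then ('C(`|N|%N, `|M|%N))%:Z else 0.

(* Main.v *)
Require Import Defs.
From mathcomp Require Import all_boot all_order all_algebra.
From mathcomp Require Import ring.
Import Order.TTheory GRing.Theory Num.Theory.

Local Open Scope ring_scope.

(** The absorption identity (M + 1) C(N + 1, M + 1) = (N + 1) C(N, M) shows
    that M + 1, hence every divisor d of M + 1, divides (N + 1) C(N, M).  When
    d is also coprime to N + 1, it divides C(N, M); this is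
    [dvdz_binz_coprime].

    Write b = a - 1.  In both parts, with d = b n + 1 or d = b n - 1, the lower
    indices M of the two binomials satisfy M + 1 = d and M + 1 = 2 d, and
    reducing modulo d gives N + 1 = - b in part (a) and N + 1 = b in part (b).
    As b n = - 1, respectively b n = 1, modulo d, in all four cases n is an
    inverse of N + 1 modulo d. *)

(** For integers outside 0 <= M <= N both binomial coefficients vanish, except
    that M = - 1 may give C(N + 1, 0) = 1 on the left; there the factor M + 1
    is 0. *)
Lemma mul_binz_diag (N M : int) :
  (M + 1) * binz (N + 1) (M + 1) = (N + 1) * binz N M.
Proof.
have [-> | M_neq] := eqVneq M (-1); first by rewrite addNr mul0r /binz mulr0.
have M1_ge0 : (0 <= M + 1) = (0 <= M) by case: M M_neq => [? | [|?]].
rewrite /binz M1_ge0 lerD2r {M1_ge0 M_neq}.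
case: ifP => [/andP[M_ge0 le_MN] | _]; last by rewrite !mulr0.
case: M M_ge0 le_MN => [m | //] _; case: N => [p | //] _.
by rewrite ![_ + 1]addrC -!intS -!PoszM -mul_bin_diag.
Qed.

Lemma dvdz_binz_coprime (d N M : int) :
  (d %| M + 1)%Z -> coprimez d (N + 1) -> (d %| binz N M)%Z.
Proof.
move=> dvd_dM co_dN.
by rewrite -(Gauss_dvdzr _ co_dN) -mul_binz_diag dvdz_mulr.
Qed.

Theorem theorem4 (a n : int) (ha : 3 <= a) (hn : 0 <= n) :
  ((a - 1) * n + 1 %|
     gcdz (binz ((a - 1) ^+ 2 * n - 1) ((a - 1) * n))
          (binz (a * (a - 1) * n) (2 * (a - 1) * n + 1)))%Z
  /\
  ((a - 1) * n - 1 %|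
     gcdz (binz ((a - 1) ^+ 2 * n - 1) ((a - 1) * n - 2))
          (binz (a * (a - 1) * n - 2) (2 * (a - 1) * n - 3)))%Z.
Proof.
(* The pairs given to [coprimezP] are Bezout coefficients for d and N + 1. *)
rewrite !dvdz_gcd; split; apply/andP; split; apply: dvdz_binz_coprime.
- exact: dvdzz.
- by apply/coprimezP; exists (1 - (a - 1) * n, n) => /=; ring.
- by apply/dvdzP; exists 2; ring.
- by apply/coprimezP; exists (1 - a * n, n) => /=; ring.
- by apply/dvdzP; exists 1; ring.
- by apply/coprimezP; exists (- 1 - (a - 1) * n, n) => /=; ring.
- by apply/dvdzP; exists 2; ring.
- by apply/coprimezP; exists (- 1 - a * n, n) => /=; ring.
Qed.
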